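(* Let $G$ be a finite abelian group with $n=\operatorname{card}(G)>1$. Then the Gelfand transform from $\ell_0^1(G)$ to $C(\{1,2,\ldots,n-1\})$ is an algebraic isomorphism. Here the maximal ideal space $\operatorname{Max}(\ell_0^1(G))$, i.e. the set of nonzero multiplicative linear functionals on $\ell_0^1(G)$, has exactly $n-1$ elements and is identified with $\{1,2,\ldots,n-1\}$.
   Context: For a finite group $G$, $\ell^1(G)$ is the algebra of functions $a\colon G\to\mathbb{C}$ with convolution product $(ab)(g)=\sum_{h\in G}a(h)b(h^{-1}g)$, and $\ell_0^1(G)=\{a\in\ell^1(G):\sum_{g\in G}a(g)=0\}$ is its augmentation ideal. $C(\{1,\ldots,n-1\})$ is the algebra of complex functions with pointwise multiplication. The Gelfand transform sends $a$ to the function $\omega\mapsto\omega(a)$ on the set of nonzero multiplicative linear functionals $\omega$. ''Algebraic isomorphism'' means isomorphism of complex algebras (no claim on norms). *)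

(* Defs.v *)
From HB Require Import structures.
From mathcomp Require Import all_boot all_order all_algebra all_fingroup.
From mathcomp Require Import complex reals.

Set Implicit Arguments.
Unset Strict Implicit.
Unset Printing Implicit Defensive.

Import GRing.Theory.
Local Open Scope ring_scope.
Local Open Scope complex_scope.

(* A type alias, so that the product on [ell1 R gT] is convolution rather than
   the canonical pointwise product of {ffun gT -> R[i]}.  The values are taken
   in (R[i])^o only to get the structure of a vector space over R[i]. *)
Definition ell1 (R : realType) (gT : finGroupType) : Type :=
  {ffun gT -> (R[i])^o}.

HB.instance Definition _ (R : realType) (gT : finGroupType) :=
  GRing.Lmodule.copy (ell1 R gT) {ffun gT -> (R[i])^o}.

Section Ell1.
Variables (R : realType) (gT : finGroupType).
Implicit Types a b c : ell1 R gT.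

Definition conv a b : ell1 R gT :=
  [ffun g => \sum_(h : gT) a h * b (h^-1 * g)%g].

Definition delta1 : ell1 R gT := [ffun g => (g == 1%g)%:R].

Lemma ell1P a b : (forall g, a g = b g) -> a = b.
Proof. by move=> eq_ab; apply/ffunP. Qed.

Lemma ell1D a b g : (a + b) g = a g + b g.
Proof. by rewrite [LHS]ffunE. Qed.

Lemma ell1Z k a g : (k *: a) g = k * a g.
Proof. by rewrite [LHS]ffunE. Qed.

Lemma ell1_0 g : (0 : ell1 R gT) g = 0.
Proof. by rewrite [LHS]ffunE. Qed.

Lemma convE a b g : conv a b g = \sum_h a h * b (h^-1 * g)%g.
Proof. by rewrite [LHS]ffunE. Qed.

Lemma delta1E g : delta1 g = (g == 1%g)%:R.
Proof. by rewrite [LHS]ffunE. Qed.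

Lemma convA : associative conv.
Proof.
move=> a b c; apply: ell1P => g; rewrite !convE.
under eq_bigr => h _.
  rewrite convE mulr_sumr (reindex_inj (mulgI h^-1%g)) /=.
  under eq_bigr => k _ do rewrite mulrA invMg invgK -mulgA mulKVg.
  over.
rewrite exchange_big /=; apply: eq_bigr => k _.
by rewrite convE mulr_suml.
Qed.

Lemma conv1l : left_id delta1 conv.
Proof.
move=> a; apply: ell1P => g; rewrite convE (bigD1 1%g) //= delta1E eqxx mul1r.
rewrite invg1 mul1g big1 ?addr0 // => h /negPf h_neq1.
by rewrite delta1E h_neq1 mul0r.
Qed.

Lemma conv1r : right_id delta1 conv.
Proof.
move=> a; apply: ell1P => g; rewrite convE (bigD1 g) //= delta1E mulVg eqxx mulr1.
rewrite big1 ?addr0 // => h h_neqg; rewrite delta1E.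
have /negPf-> : (h^-1 * g)%g != 1%g by rewrite -eq_mulVg1.
by rewrite mulr0.
Qed.

Lemma convDl : left_distributive conv +%R.
Proof.
move=> a b c; apply: ell1P => g; rewrite ell1D !convE -big_split /=.
by apply: eq_bigr => h _; rewrite ell1D mulrDl.
Qed.

Lemma convDr : right_distributive conv +%R.
Proof.
move=> a b c; apply: ell1P => g; rewrite ell1D !convE -big_split /=.
by apply: eq_bigr => h _; rewrite ell1D mulrDr.
Qed.

Lemma delta1_neq0 : delta1 != 0.
Proof.
apply/eqP => /(congr1 (fun a : ell1 R gT => a 1%g)) /eqP.
by rewrite delta1E ell1_0 eqxx oner_eq0.
Qed.

HB.instance Definition _ := GRing.Zmodule_isNzRing.Build (ell1 R gT)
  convA conv1l conv1r convDl convDr delta1_neq0.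

Lemma convZl (k : R[i]) a b : k *: (a * b) = (k *: a) * b.
Proof.
apply: ell1P => g; rewrite ell1Z !convE mulr_sumr.
by apply: eq_bigr => h _; rewrite ell1Z mulrA.
Qed.

Lemma convZr (k : R[i]) a b : k *: (a * b) = a * (k *: b).
Proof.
apply: ell1P => g; rewrite ell1Z !convE mulr_sumr.
by apply: eq_bigr => h _; rewrite ell1Z mulrCA.
Qed.

HB.instance Definition _ :=
  GRing.Lmodule_isLalgebra.Build R[i] (ell1 R gT) convZl.
HB.instance Definition _ :=
  GRing.Lalgebra_isAlgebra.Build R[i] (ell1 R gT) convZr.

Definition augmentation_ideal : {pred ell1 R gT} :=
  [pred a : ell1 R gT | \sum_(g : gT) a g == 0].

Lemma augmentation_ideal_submod : submod_closed augmentation_ideal.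
Proof.
split=> [|k a b]; rewrite !inE.
  by rewrite big1 // => g _; rewrite ell1_0.
move=> /eqP a0 /eqP b0; under eq_bigr => g _ do rewrite ell1D ell1Z.
by rewrite big_split /= -mulr_sumr a0 b0 mulr0 addr0.
Qed.

HB.instance Definition _ :=
  GRing.isSubmodClosed.Build R[i] (ell1 R gT) augmentation_ideal
    augmentation_ideal_submod.

Lemma augmentation_idealMr a b :
  b \in augmentation_ideal -> a * b \in augmentation_ideal.
Proof.
rewrite !inE => /eqP b0; under eq_bigr => g _ do rewrite convE.
rewrite exchange_big big1 //= => h _.
rewrite -mulr_sumr; suff -> : \sum_g b (h^-1 * g)%g = 0 by rewrite mulr0.
by rewrite -[RHS]b0 [RHS](reindex_inj (mulgI h^-1%g)).
Qed.

Record ell10 := Ell10 { ell10_val :> ell1 R gT;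
                        _ : ell10_val \in augmentation_ideal }.

HB.instance Definition _ := [isSub for ell10_val].
HB.instance Definition _ := [Choice of ell10 by <:].
HB.instance Definition _ := [SubChoice_isSubLmodule of ell10 by <:].

(* The library has no structure for algebras without a given unit, so the
   product of the augmentation ideal is a plain function. *)
Definition ell10_mul (x y : ell10) : ell10 :=
  Ell10 (augmentation_idealMr (ell10_val x) (valP y)).

Definition multiplicative_functional (w : ell10 -> R[i]) : Prop :=
  [/\ scalar w,
      {morph w : x y / ell10_mul x y >-> x * y} &
      exists x, w x != 0].

Definition Max_ell10 : Type :=
  {w : ell10 -> R[i] | multiplicative_functional w}.

Definition gelfand (x : ell10) (w : Max_ell10) : R[i] := sval w x.

(* The Gelfand transform with values in C({1, ..., m}), the points of
   Max_ell10 being labelled through e; {1, ..., m} is rendered by 'I_m. *)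
Definition gelfand_on (m : nat) (e : 'I_m -> Max_ell10) (x : ell10) :
    {ffun 'I_m -> (R[i])^o} :=
  [ffun i => gelfand x (e i)].

Definition algebraic_isomorphism (m : nat)
    (phi : ell10 -> {ffun 'I_m -> (R[i])^o}) : Prop :=
  [/\ linear phi,
      {morph phi : x y / ell10_mul x y >-> x * y} &
      bijective phi].

End Ell1.

(* Main.v *)
(* The matrices of the regular representation of G commute, and each of them is
   annihilated by X^n - 1, which is separable and split; hence they are
   simultaneously diagonalizable.  The diagonal entries are n multiplicative
   functions on G, and they separate ell^1(G) because the regular matrices are
   linearly independent.  So the Fourier transform identifies ell^1(G) with C^n,
   the augmentation ideal being the kernel of the coordinate of the trivial
   character.  Finally, a nonzero multiplicative functional on C^(n-1) is nonzero
   on some minimal idempotent, hence is the corresponding coordinate. *)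

From HB Require Import structures.
Require Import Defs.
From mathcomp Require Import all_boot all_order all_algebra all_fingroup.
From mathcomp Require Import cyclic cyclotomic separable mxrepresentation boolp.
From mathcomp Require Import complex reals.

Set Implicit Arguments.
Unset Strict Implicit.
Unset Printing Implicit Defensive.

Import GRing.Theory Num.Theory.
Local Open Scope ring_scope.
Local Open Scope complex_scope.

(** Needed for functionals whose linearity is only a hypothesis, with no bundled structure. *)
Lemma scalar_sum (K : comNzRingType) (V : lmodType K) (w : V -> K)
    (I : finType) (a : I -> K) (x : I -> V) :
  scalar w -> w (\sum_i a i *: x i) = \sum_i a i * w (x i).
Proof.
move=> w_lin.
pose wL : {scalar V} := HB.pack w (GRing.isLinear.Build _ _ _ _ w w_lin).
rewrite -[w]/(wL : V -> K) linear_sum.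
by apply: eq_bigr => i _; rewrite linearZ.
Qed.

Lemma diagonalizable_repr (F : closedFieldType) (gT : finGroupType)
    (G : {group gT}) n (rG : mx_representation F G n) x :
  x \in G -> #|G|%:R != 0 :> F -> diagonalizable (rG x).
Proof.
case: n rG => [|n] rG Gx cardG_neq0.
  (* Size 0 is split off because polynomials are evaluated at matrices of size [n.+1]. *)
  by rewrite flatmx0; apply: diagonalizable0.
have [rs] := closed_field_poly_normal ('X^#|G| - 1 : {poly F}).
rewrite (monicP (monicXnsubC _ (cardG_gt0 G))) scale1r => def_p.
apply/diagonalizableP; exists rs.
  by rewrite -separable_prod_XsubC -def_p separable_Xn_sub_1.
rewrite -def_p; apply: mxminpoly_min.
rewrite rmorphB rmorphXn /= horner_mx_X rmorph1 -repr_mxX // expg_cardG //.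
by rewrite repr_mx1 subrr.
Qed.

(** In a common eigenbasis of the regular representation, [chi i x] is the [i]-th diagonal entry of
    [rG x]. The second clause, totality, replaces the orthogonality relations below. *)
Lemma abelian_characters (F : closedFieldType) (gT : finGroupType) n :
    abelian [set: gT] -> #|gT| = n -> n%:R != 0 :> F ->
  exists chi : 'I_n -> gT -> F,
    (forall i, {morph chi i : x y / (x * y)%g >-> x * y}) /\
    (forall a : gT -> F,
       (forall i, \sum_g a g * chi i g = 0) -> forall g, a g = 0).
Proof.
rewrite -cardsT => abG <- cardG_neq0.
pose rG := regular_repr F [set: gT].
have : codiagonalizable [seq rG x | x <- enum gT].
  apply/codiagonalizableP; split=> [_ _ /mapP[x _ ->] /mapP[y _ ->]|].
    by rewrite /comm_mx -!repr_mxM ?in_setT // (centsP abG) ?in_setT.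
  by move=> _ /mapP[x _ ->]; apply: diagonalizable_repr; rewrite ?in_setT.
move=> [P Punit /allP Pdiag].
pose D x := P *m rG x *m invmx P.
have DE x i j : i != j -> D x i j = 0.
  have /Pdiag/= : rG x \in [seq rG x | x <- enum gT] by rewrite map_f ?mem_enum.
  by move=> /(diagonalizable_forP _ Punit) PxP i_neqj; apply: PxP.
have DM x y : D (x * y)%g = D x *m D y.
  by rewrite /D repr_mxM ?in_setT // !mulmxA mulmxKV.
exists (fun i x => D x i i); split=> [i x y|a a0 g].
  rewrite DM mxE (bigD1 i) //= big1 ?addr0 // => j j_neqi.
  by rewrite DE ?mul0r // eq_sym.
have : \sum_x a x *: D x = 0.
  apply/matrixP=> i j; rewrite summxE mxE; have [<-|i_neqj] := eqVneq i j.
    by rewrite -[RHS](a0 i); apply: eq_bigr => x _; rewrite mxE.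
  by rewrite big1 // => x _; rewrite mxE DE ?mulr0.
move=> /(congr1 (fun A => invmx P *m A *m P)); rewrite mulmx0 mul0mx.
rewrite mulmx_sumr mulmx_suml.
under eq_bigr => x _ do
  rewrite -scalemxAr -scalemxAl !mulmxA mulVmx // mul1mx mulmxKV //.
(* The row of 1 in [rG x] is the basis vector of [x], so entry (1, g) of the sum is [a g]. *)
move=> /matrixP /(_ (gring_index [set: gT] 1%g) (gring_index [set: gT] g)).
rewrite summxE mxE (bigD1 g) //= big1 => [|x x_neqg].
  by rewrite mxE !mxE gring_indexK ?in_setT // mul1g !eqxx mulr1 addr0.
rewrite !mxE gring_indexK ?in_setT // mul1g eqxx /=.
rewrite (inj_in_eq (can_in_inj (@gring_indexK _ [set: gT]))) ?in_setT //.
by rewrite eq_sym (negPf x_neqg) mulr0.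
Qed.

Section Fourier.
Variables (R : realType) (gT : finGroupType) (n : nat) (chi : 'I_n -> gT -> R[i]).
Hypothesis card_G : #|gT| = n.
Hypothesis chiM : forall i, {morph chi i : x y / (x * y)%g >-> x * y}.
Hypothesis chi_total : forall a : gT -> R[i],
  (forall i, \sum_g a g * chi i g = 0) -> forall g, a g = 0.

Definition fourier i (a : ell1 R gT) : R[i] := \sum_g a g * chi i g.

Lemma fourier_is_scalar i : scalar (fourier i).
Proof.
move=> k a b; rewrite mulr_sumr -big_split /=; apply: eq_bigr => g _.
by rewrite ell1D ell1Z mulrDl mulrA.
Qed.

HB.instance Definition _ i :=
  GRing.isLinear.Build R[i] (ell1 R gT) R[i] *%R (fourier i) (fourier_is_scalar i).

Lemma fourierM i : {morph fourier i : a b / a * b}.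
Proof.
move=> a b; rewrite /fourier mulr_suml.
under eq_bigr => g _ do rewrite convE mulr_suml.
rewrite exchange_big /=; apply: eq_bigr => h _.
rewrite mulr_sumr (reindex_inj (mulgI h)) /=; apply: eq_bigr => g _.
by rewrite mulKg chiM mulrACA.
Qed.

Lemma fourier_inj a b : (forall i, fourier i a = fourier i b) -> a = b.
Proof.
move=> eq_ab; apply/eqP; rewrite -subr_eq0; apply/eqP/ell1P => g.
rewrite ell1_0; move: g; apply: chi_total => i.
by rewrite -/(fourier i (a - b)) linearB /= eq_ab subrr.
Qed.

(** The character table [X] is square, and totality makes its rows independent; hence it is
    invertible. *)
Lemma fourier_surj (f : 'I_n -> R[i]) : exists a, forall i, fourier i a = f i.
Proof.
pose rank g := cast_ord card_G (enum_rank g).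
have [elt rankK eltK] : bijective rank.
  exact: bij_comp (Bijective (cast_ordK _) (cast_ordKV _)) (enum_rank_bij gT).
pose X : 'M[R[i]]_n := \matrix_(j, i) chi i (elt j).
have mulX v i : (v *m X) 0 i = \sum_g v 0 (rank g) * chi i g.
  rewrite mxE (reindex rank) /=; last by exists elt => ? _.
  by apply: eq_bigr => g _; rewrite mxE rankK.
have Xu : X \in unitmx.
  rewrite -row_free_unit; apply: inj_row_free => v vX0; apply/rowP => j.
  rewrite mxE -(eltK j); apply: (chi_total (a := fun g => v 0 (rank g))).
  by move=> i; rewrite -mulX vX0 mxE.
pose v := \row_i f i *m invmx X.
exists [ffun g => v 0 (rank g)] => i.
rewrite /fourier; under eq_bigr => g _ do rewrite ffunE.
by rewrite -mulX mulmxKV // mxE.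
Qed.

(** Otherwise every [chi i] would sum to 0 over the group, and totality would kill the constant
    function 1. *)
Lemma trivial_character : exists i, forall g, chi i g = 1.
Proof.
have [/existsP[i /forallP chi1]|/existsPn chi_neq1] :=
  boolP [exists i, [forall g, chi i g == 1]].
  by exists i => g; apply/eqP.
suff /(_ 1%g)/eqP : forall g : gT, (1 : R[i]) = 0 by rewrite oner_eq0.
apply: (chi_total (a := fun=> 1)) => i.
have /forallPn[h chih_neq1] := chi_neq1 i.
under eq_bigr do rewrite mul1r.
(* Translation by [h] permutes the terms; as [chi i h] is not 1, [s] must vanish. *)
set s := \sum_g chi i g; have : chi i h * s = s.
  rewrite mulr_sumr [RHS](reindex_inj (mulgI h)).
  by apply: eq_bigr => g _; rewrite chiM.
move=> /eqP; rewrite -subr_eq0 -[X in _ - X]mul1r -mulrBl mulf_eq0 subr_eq0.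
by rewrite (negPf chih_neq1) => /eqP.
Qed.

End Fourier.

(** The coordinates are the Fourier coefficients at the nontrivial characters, numbered by
    [lift i0]; the [E j] are the minimal idempotents dual to them. *)
Lemma ell10_coordinates (R : realType) (gT : finGroupType) n :
    abelian [set: gT] -> #|gT| = n.+1 ->
  exists (c : 'I_n -> ell10 R gT -> R[i]) (E : 'I_n -> ell10 R gT),
    [/\ forall k, multiplicative_functional (c k),
        forall x y, (forall k, c k x = c k y) -> x = y &
        forall k j, c k (E j) = (k == j)%:R].
Proof.
move=> abG cardG.
have n1_neq0 : n.+1%:R != 0 :> R[i] by rewrite pnatr_eq0.
have [chi [chiM chi_total]] : exists chi : 'I_n.+1 -> gT -> R[i], _ :=
  abelian_characters abG cardG n1_neq0.
have [i0 chi0] := trivial_character chiM chi_total.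
have augE a : (a \in @augmentation_ideal R gT) = (fourier chi i0 a == 0).
  by rewrite inE /fourier; under [in RHS]eq_bigr do rewrite chi0 mulr1.
have /fin_all_exists[E EE] (j : 'I_n) : exists x : ell10 R gT,
    forall i, fourier chi i (val x) = (i == lift i0 j)%:R.
  have [a aE] := fourier_surj cardG chi_total (fun i => (i == lift i0 j)%:R).
  have a_aug : a \in @augmentation_ideal R gT.
    by rewrite augE aE (negPf (neq_lift _ _)).
  by exists (Ell10 a_aug).
pose c k (x : ell10 R gT) := fourier chi (lift i0 k) (val x).
have cE k j : c k (E j) = (k == j)%:R by rewrite /c EE (inj_eq lift_inj).
exists c, E; split=> // [k|x y eq_c].
  split=> [a x y|x y|]; rewrite /c.
  - by rewrite !linearP.
  - exact: fourierM.
  - by exists (E k); rewrite -/(c k _) cE eqxx oner_eq0.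
apply: val_inj; apply: (fourier_inj chi_total) => i.
(* At [i0] both coefficients are 0, by membership in the ideal. *)
case: (unliftP i0 i) => [k ->|->]; first exact: eq_c.
by have := valP x; have := valP y; rewrite !augE => /eqP-> /eqP->.
Qed.

Section Coordinates.
Variables (R : realType) (gT : finGroupType) (n : nat).
Variables (c : 'I_n -> ell10 R gT -> R[i]) (E : 'I_n -> ell10 R gT).
Hypothesis c_mult : forall k, multiplicative_functional (c k).
Hypothesis c_inj : forall x y, (forall k, c k x = c k y) -> x = y.
Hypothesis cE : forall k j, c k (E j) = (k == j)%:R.

Lemma coord_sum (f : 'I_n -> R[i]) k : c k (\sum_j f j *: E j) = f k.
Proof.
have [c_lin _ _] := c_mult k; rewrite scalar_sum // (bigD1 k) //= cE eqxx mulr1.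
by rewrite big1 ?addr0 // => j /negPf j_neqk; rewrite cE eq_sym j_neqk mulr0.
Qed.

Lemma multiplicative_functional_coord (w : ell10 R gT -> R[i]) :
  multiplicative_functional w -> exists k, w =1 c k.
Proof.
move=> [w_lin wM [x wx_neq0]].
have [/existsP[k wEk_neq0]|/existsPn wE0] := boolP [exists k, w (E k) != 0].
  (* That is, [y * E k = c k y *: E k]; applying [w] and cancelling [w (E k)] gives
     [w y = c k y]. *)
  have mulE y : ell10_mul y (E k) = \sum_j (if j == k then c k y else 0) *: E j.
    apply: c_inj => j; rewrite coord_sum; have [_ -> _] := c_mult j.
    by rewrite cE; case: eqP => [->|_]; rewrite ?mulr1 ?mulr0.
  exists k => y; apply: (mulIf wEk_neq0).
  rewrite -wM mulE scalar_sum // (bigD1 k) //= eqxx big1 ?addr0 // => j.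
  by move=> /negPf->; rewrite mul0r.
(* If [w] kills every [E k], it kills their span, which contains [x]. *)
case/eqP: wx_neq0; have -> : x = \sum_k c k x *: E k.
  by apply: c_inj => k; rewrite coord_sum.
rewrite scalar_sum // big1 // => k _.
by have /negPn/eqP-> := wE0 k; rewrite mulr0.
Qed.

Definition Max_coord k : Max_ell10 R gT := exist _ (c k) (c_mult k).

Lemma Max_coord_bij : bijective Max_coord.
Proof.
have /choice[d dE] (w : Max_ell10 R gT) : exists k, sval w =1 c k.
  exact/multiplicative_functional_coord/(svalP w).
exists d => [k|w].
  have /eqP := dE (Max_coord k) (E k); rewrite /= !cE eqxx.
  by have [//|_] := eqVneq (d (Max_coord k)) k; rewrite oner_eq0.
move: (d w) (dE w) => k; case: w => w w_mult /= /funext w_eq.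
by subst w; congr (exist _ _ _); apply: Prop_irrelevance.
Qed.

Lemma gelfand_on_isomorphism (e : 'I_n -> Max_ell10 R gT) :
  bijective e -> algebraic_isomorphism (gelfand_on e).
Proof.
move=> [d eK dK]; split=> [a x y|x y|].
- by apply/ffunP => i; rewrite !ffunE /gelfand; have [-> _ _] := svalP (e i).
- by apply/ffunP => i; rewrite !ffunE /gelfand; have [_ -> _] := svalP (e i).
(* [d (Max_coord k)] is the label that [e] gives to [c k], so [f] is read through this
   relabelling. *)
exists (fun f : {ffun _ -> _} => \sum_k f (d (Max_coord k)) *: E k) => [x|f].
  by apply: c_inj => k; rewrite coord_sum ffunE dK.
apply/ffunP => i; rewrite ffunE /gelfand.
have [d' _ d'K] := Max_coord_bij.
by rewrite -[e i]d'K /= coord_sum d'K eK.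
Qed.

End Coordinates.

Theorem theorem5p5 (R : realType) (gT : finGroupType) (n : nat)
    (abelian_G : abelian [set: gT]) (card_G : #|gT| = n) (n_gt1 : (1 < n)%N) :
  (exists e : 'I_n.-1 -> Max_ell10 R gT, bijective e) /\
  (forall e : 'I_n.-1 -> Max_ell10 R gT, bijective e ->
     algebraic_isomorphism (gelfand_on e)).
Proof.
(* From here the order is [n.+1], and [n] counts the nontrivial characters. *)
case: n n_gt1 card_G => // n _ card_G.
have [c [E [c_mult c_inj cE]]] := ell10_coordinates R abelian_G card_G.
split; first by exists (Max_coord c_mult); apply: Max_coord_bij c_inj cE.
exact: gelfand_on_isomorphism c_mult c_inj cE.
Qed.
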